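(* If $Q$ is a 2-connected network (of total length $1$), then the value of the game $\Gamma'_1(Q)$ is $1/4$.
   Context: A network $Q$ is obtained from a finite connected graph (vertices are called nodes, edges are called arcs) by assigning to each edge $e$ a length $\lambda(e)>0$ and identifying $e$ with an open interval of that length joining its end nodes; $\lambda$ also denotes the resulting length measure on $Q$ (nodes have measure $0$), and $Q$ carries the shortest-path metric. The total length is $\lambda(Q)=1$. A network is 2-connected if it remains connected upon removal of any node, i.e. $Q\setminus\{v\}$ is connected for every node $v$. The game $\Gamma'_1(Q)$ is the following zero-sum game. The defender chooses a point of $Q$ (the location of the single booby trap) and the attacker chooses a connected subset $S\subseteq Q$, without knowing each other's choice. The payoff to the attacker is $\lambda(S)$ if the booby trap is not in $S$, and $0$ otherwise; the attacker maximizes and the defender minimizes the expected payoff. Mixed strategies are random choices of pure strategies (such that the payoff against each opposing pure strategy is measurable). The game has value $V$ if for every $\varepsilon>0$ the attacker has a mixed strategy with expected payoff at least $V-\varepsilon$ against every pure strategy of the defender, and the defender has a mixed strategy with expected payoff at most $V+\varepsilon$ against every pure strategy of the attacker. *)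

(* Defs.v *)
From HB Require Import structures.
From mathcomp Require Import all_boot all_order all_algebra.
From mathcomp Require Import lra.
From mathcomp Require Import all_classical all_reals all_analysis.
From mathcomp Require Import measurable_realfun.

Set Implicit Arguments.
Unset Strict Implicit.
Unset Printing Implicit Defensive.

Import Order.TTheory GRing.Theory Num.Theory.
Import numFieldNormedType.Exports.

Local Open Scope classical_set_scope.
Local Open Scope ring_scope.

(* Parallel arcs and loops are allowed; the orientation of an arc from [src] to
   [tgt] only serves to fix the coordinate along it. *)
Record network (R : realType) := Network {
  nodes : finType;
  arcs : finType;
  src : arcs -> nodes;
  tgt : arcs -> nodes;
  len : arcs -> R;
  len_gt0 : forall e, 0 < len e;
  graph_connected : forall u v, connect
    [rel u v | [exists e, ((src e == u) && (tgt e == v))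
                       || ((src e == v) && (tgt e == u))]] u v }.

Section points.
Context {R : realType} {Q : network R}.

Inductive npoint : Type :=
| Node of nodes Q
| Inner (e : arcs Q) (t : R) of 0 < t < len e.

HB.instance Definition _ := gen_eqMixin npoint.
HB.instance Definition _ := gen_choiceMixin npoint.

(* The point at coordinate t of the closed arc e. It is meant for t in
   [0, len e] and is clamped to the end nodes outside. *)
Definition arc_point (e : arcs Q) (t : R) : npoint :=
  match @idP (0 < t < len e) with
  | ReflectT h => Inner h
  | ReflectF _ => Node (if t <= 0 then src e else tgt e)
  end.

(* [path_length x y l]: l is the length of some path from x to y made of
   finitely many segments, each contained in a closed arc. *)
Inductive path_length : npoint -> npoint -> R -> Prop :=
| path_nil x : path_length x x 0
| path_step e s t y l : 0 <= s <= len e -> 0 <= t <= len e ->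
    path_length (arc_point e t) y l ->
    path_length (arc_point e s) y (`|s - t| + l).

Definition path_dist (x y : npoint) : R := inf [set l | path_length x y l].

Lemma arc_point_inner e t (h : 0 < t < len e) : arc_point e t = Inner h.
Proof.
by rewrite /arc_point; case: {-}_ / idP => // h'; rewrite (bool_irrelevance h h').
Qed.

Lemma arc_point0 e : arc_point e 0 = Node (src e).
Proof.
by rewrite /arc_point; case: {-}_ / idP => h; rewrite ?lexx//;
  exfalso; move: h; rewrite ltxx.
Qed.

Lemma arc_point_len e : arc_point e (len e) = Node (tgt e).
Proof.
rewrite /arc_point; case: {-}_ / idP => h.
  by exfalso; move: h; rewrite ltxx andbF.
by rewrite leNgt len_gt0.
Qed.

Variant arc_point_spec e t : npoint -> Prop :=
| ArcSrc of t = 0 : arc_point_spec e t (Node (src e))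
| ArcTgt of t = len e : arc_point_spec e t (Node (tgt e))
| ArcInner (h : 0 < t < len e) : arc_point_spec e t (Inner h).

Lemma arc_pointP e t : 0 <= t <= len e -> arc_point_spec e t (arc_point e t).
Proof.
move=> /andP[t0 tl]; have [t_gt0|t_le0] := ltP 0 t; last first.
  have -> : t = 0 by apply/eqP; rewrite eq_le t_le0.
  by rewrite arc_point0; constructor.
have [t_lt|t_ge] := ltP t (len e); last first.
  have -> : t = len e by apply/eqP; rewrite eq_le tl.
  by rewrite arc_point_len; constructor.
have h : 0 < t < len e by rewrite t_gt0.
by rewrite (arc_point_inner h); constructor.
Qed.

Lemma path_length_ge0 x y l : path_length x y l -> 0 <= l.
Proof. by elim=> // *; rewrite addr_ge0. Qed.

Lemma path_length_trans x y z l l' :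
  path_length x y l -> path_length y z l' -> path_length x z (l + l').
Proof.
elim=> [x0|e s t y0 l0 hs ht _ IH] yz; first by rewrite add0r.
by rewrite -addrA; apply: path_step => //; exact: IH.
Qed.

Lemma path_length_arc e s t : 0 <= s <= len e -> 0 <= t <= len e ->
  path_length (arc_point e s) (arc_point e t) `|s - t|.
Proof. by move=> hs ht; rewrite -[`|_|]addr0; apply: path_step => //; constructor. Qed.

Lemma path_length_sym x y l : path_length x y l -> path_length y x l.
Proof.
elim=> [x0|e s t y0 l0 hs ht _ IH]; first by constructor.
rewrite addrC; apply: path_length_trans IH _.
by rewrite distrC; exact: path_length_arc.
Qed.

Lemma path_length_node u v : exists l, path_length (Node u) (Node v) l.
Proof.
have /connectP[p] := graph_connected u v.
elim: p u => [|w p IH] u /=; first by move=> _ ->; exists 0; constructor.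
move=> /andP[/existsP[e uw] wp] /(IH _ wp)[l wv].
have h0 : 0 <= (0 : R) <= len e by rewrite lexx ltW ?len_gt0.
have h1 : 0 <= len e <= len e by rewrite lexx ltW ?len_gt0.
have st := path_length_arc h0 h1; rewrite arc_point0 arc_point_len in st.
case/orP: uw => /andP[/eqP su /eqP tw].
- by rewrite su tw in st; eexists; exact: path_length_trans st wv.
- rewrite su tw in st; eexists.
  exact: path_length_trans (path_length_sym st) wv.
Qed.

Lemma path_length_to_node x : exists u l, path_length x (Node u) l.
Proof.
case: x => [u|e t h]; first by exists u, 0; constructor.
exists (src e), `|t - 0|; rewrite -arc_point0 -(arc_point_inner h).
apply: path_length_arc; first by case/andP: h => /ltW -> /ltW ->.
by rewrite lexx ltW ?len_gt0.
Qed.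

Lemma path_length_exists x y : [set l | path_length x y l] !=set0.
Proof.
have [u [l xu]] := path_length_to_node x.
have [v [l' yv]] := path_length_to_node y.
have [m uv] := path_length_node u v.
exists (l + m + l').
exact: path_length_trans (path_length_trans xu uv) (path_length_sym yv).
Qed.

Lemma path_length_inf x y : has_inf [set l | path_length x y l].
Proof.
by split; [exact: path_length_exists|exists 0 => l /= /path_length_ge0].
Qed.

Lemma path_dist_le x y l : path_length x y l -> path_dist x y <= l.
Proof. by move=> xyl; apply: ge_inf => //; case: (path_length_inf x y). Qed.

Lemma path_dist_ge x y c :
  (forall l, path_length x y l -> c <= l) -> c <= path_dist x y.
Proof. by move=> h; apply: lb_le_inf => //; exact: path_length_exists. Qed.

Lemma path_distxx x : path_dist x x = 0.
Proof.
apply/eqP; rewrite eq_le path_dist_le ?path_dist_ge//; last by constructor.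
by move=> l /path_length_ge0.
Qed.

Lemma path_dist_sym x y : path_dist x y = path_dist y x.
Proof.
by congr inf; apply/seteqP; split=> l /=; exact: path_length_sym.
Qed.

Lemma path_dist_triangle y x z : path_dist x z <= path_dist x y + path_dist y z.
Proof.
rewrite -lerBlDr; apply: path_dist_ge => l xy.
rewrite lerBlDr addrC -lerBlDr; apply: path_dist_ge => l' yz.
by rewrite lerBlDr addrC; apply: path_dist_le; exact: path_length_trans xy yz.
Qed.

Lemma path_dist_lipschitz (f : npoint -> R) (g : arcs Q -> R -> R) x y :
  (forall e t, 0 <= t <= len e -> f (arc_point e t) = g e t) ->
  (forall e s t, g e t - g e s <= `|s - t|) ->
  f y - f x <= path_dist x y.
Proof.
move=> fg lip; apply: path_dist_ge => l; elim=> [z|e s t z {}l hs ht _ IH].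
  by rewrite subrr.
by have := lip e s t; rewrite -!fg//; lra.
Qed.

Let min_lip (a b c d k : R) :
  a - c <= k -> b - d <= k -> Num.min a b - Num.min c d <= k.
Proof.
by move=> ac bd; rewrite !minEle; case: ifPn; case: ifPn;
  rewrite -?ltNge => *; lra.
Qed.

Let lip_id (s t : R) : t - s <= `|s - t|.
Proof. by rewrite distrC ler_norm. Qed.

Let len_min : exists2 m : R, 0 < m & forall e : arcs Q, m <= len e.
Proof.
exists (\big[Num.min/1]_(e : arcs Q) len e).
  by elim/big_ind: _ => // [x y x0 y0|e _]; rewrite ?lt_min ?x0 ?len_gt0.
by move=> e; exact: bigmin_le_cond.
Qed.

Lemma path_dist_positivity x y : path_dist x y = 0 -> x = y.
Proof.
have [//|xy] := eqVneq x y.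
suff : 0 < path_dist x y by move=> /[swap] ->; rewrite ltxx.
case: x xy => [v|e0 t0 h0] xy.
- have [m m0 mlen] := len_min.
  pose g e t : R := Num.min m (Num.min (if src e == v then t else m)
                               (if tgt e == v then len e - t else m)).
  pose f (z : npoint) := match z with
    | Node u => if u == v then 0 else m
    | Inner e t _ => g e t end.
  apply: (@lt_le_trans _ _ (f y - f (Node v))); last first.
    apply: (@path_dist_lipschitz f g) => [e t te|e s t].
      case/andP: (te) => ? ?; have ? := mlen e.
      case: (arc_pointP te) => //= et; rewrite /g et; last first.
        case: ifPn => ?; rewrite ?subrr !minEle; repeat case: ifPn;
          rewrite -?ltNge => *; lra.
      case: ifPn => ?; rewrite ?subr0 !minEle; repeat case: ifPn;
        rewrite -?ltNge => *; lra.
    have k0 : 0 <= `|s - t| by [].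
    have := lip_id s t; have := lip_id t s; rewrite (distrC t s) => ? ?.
    by rewrite /g; apply: min_lip; first lra; apply: min_lip; case: ifPn => _; lra.
  rewrite /= eqxx subr0; case: y xy => [u|e t ht] /= uv.
    by have [E|//] := eqVneq u v; rewrite E eqxx in uv.
  case/andP: (ht) => t_gt0 t_lt; rewrite /g !lt_min m0 /=.
  by apply/andP; split; case: ifPn => _; rewrite ?subr_gt0.
- case/andP: (h0) => t0_gt0 t0_lt.
  pose m := Num.min t0 (len e0 - t0).
  have m0 : 0 < m by rewrite lt_min t0_gt0 subr_gt0.
  have m1 : m <= t0 by rewrite /m ge_min lexx.
  have m2 : m <= len e0 - t0 by rewrite /m ge_min lexx orbT.
  pose g e t : R := Num.min m (if e == e0 then `|t - t0| else m).
  pose f (z : npoint) := match z with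
    | Node u => m
    | Inner e t _ => g e t end.
  apply: (@lt_le_trans _ _ (f y - f (Inner h0))); last first.
    apply: (@path_dist_lipschitz f g) => [e t te|e s t].
      case: (arc_pointP te) => //= et; rewrite /g et.
        by case: ifPn => _; rewrite ?minxx// sub0r normrN gtr0_norm//;
          rewrite min_l.
      case: ifPn => [/eqP ->|_]; rewrite ?minxx//.
      by rewrite gtr0_norm ?subr_gt0// min_l.
    have k0 : 0 <= `|s - t| by [].
    rewrite /g; apply: min_lip; first lra.
    case: ifPn => _; last lra.
    by have := ler_distD s t t0; rewrite (distrC t s); lra.
  rewrite /= /g eqxx subrr normr0 [Num.min m 0]min_r ?ltW// subr0.
  case: y xy => [u|e t ht] /= xy //; rewrite lt_min m0 /=.
  case: ifPn => // /eqP ee; subst e; rewrite normr_gt0 subr_eq0.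
  apply: contra xy => /eqP tt; subst t.
  by rewrite (bool_irrelevance ht h0) eqxx.
Qed.

End points.
Arguments npoint {R} Q.

HB.instance Definition _ (R : realType) (Q : network R) :=
  isMetric.Build R (npoint Q) (@path_distxx R Q) (@path_dist_positivity R Q)
    (@path_dist_sym R Q) (@path_dist_triangle R Q).

Definition two_connected (R : realType) (Q : network R) : Prop :=
  forall v : nodes Q, connected (~` [set Node v]).

(* [lebesgue_measure] is total (the outer measure off the measurable sets), so
   no measurability of S is required. Connected sets, to which this is applied,
   meet each arc in a finite union of intervals. *)
Definition length_measure (R : realType) (Q : network R) (S : set (npoint Q)) :
    \bar R :=
  (\sum_(e : arcs Q)
    lebesgue_measure (`]0%R, len e[%classic `&` (arc_point e @^-1` S)))%E.

(* A mixed strategy over the pure strategies X, against the opposing pure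
   strategies Y, in a game with payoff u: a random element of X. *)
Record mixed (R : realType) (X Y : Type) (u : X -> Y -> \bar R) := Mixed {
  disp : measure_display;
  sample : measurableType disp;
  law : probability sample R;
  pure : sample -> X;
  measurable_payoff : forall y,
    measurable_fun [set: sample] (fun w => u (pure w) y) }.
Arguments pure {R X Y u}.

Definition expected_payoff (R : realType) (X Y : Type) (u : X -> Y -> \bar R)
    (m : mixed u) (y : Y) : \bar R :=
  (\int[law m]_w u (pure m w) y)%E.

(* Zero-sum game: X maximizes u, Y minimizes it. *)
Definition has_value (R : realType) (X Y : Type) (u : X -> Y -> \bar R) (V : R) :=
  forall eps : R, 0 < eps ->
    (exists m : mixed u,
       forall y, ((V - eps)%:E <= expected_payoff m y)%E) /\
    (exists m : mixed (fun y x => u x y),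
       forall x, (expected_payoff m x <= (V + eps)%:E)%E).

Definition connected_set (R : realType) (Q : network R) : Type :=
  {S : set (npoint Q) | connected S}.

Definition one_trap_payoff (R : realType) (Q : network R)
    (S : connected_set Q) (trap : npoint Q) : \bar R :=
  if trap \in sval S then 0%E else length_measure (sval S).

(* Main.v *)
(* A uniformly distributed trap lies in a connected set of length l with
   probability l, so the attacker gets l (1 - l), which is at most 1/4. For this
   the trace of a connected set on an arc has to be measurable.

   Conversely the attacker gets at least 1/2 * 1/2 by choosing at random one of
   two disjoint connected sets of length at least 1/2. To find them, regard the
   nodes and the open arcs as cells of a finite graph, start with one node and
   enlarge the set A of chosen cells one cell at a time so that both A and its
   complement stay connected; 2-connectedness makes this possible. The cell at
   which the length passes 1/2 is an arc, and it is shared between A and the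
   rest of the complement. *)
From HB Require Import structures.
Require Import Defs.
From mathcomp Require Import all_boot.
From mathcomp Require Import boolp.

Set Implicit Arguments.
Unset Strict Implicit.
Unset Printing Implicit Defensive.

Local Open Scope set_scope.

(** * Connected sets of vertices in a finite graph *)

Section graph_connectedness.
Context {T : finType} (adj : rel T).
Hypothesis adj_sym : symmetric adj.
Implicit Types (A B C X : {set T}) (x y v w : T).

Definition closed_in B X :=
  forall x y, x \in X -> y \in B -> adj x y -> y \in X.

(* Phrased like topological connectedness, for finite unions of cells below. *)
Definition conn B :=
  forall X, X \subset B -> X != set0 -> closed_in B X -> X = B.

Lemma conn1 x : conn [set x].
Proof.
move=> X; rewrite subset1 => /orP[/eqP -> //|/eqP ->].
by rewrite eqxx.
Qed.

Lemma conn_setU1 C x y : conn C -> x \in C -> adj x y -> conn (y |: C).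
Proof.
move=> cC xC xy X Xs X0 Xcl.
have [/eqP XC0|XC] := boolP (X :&: C == set0).
  have X1 z : z \in X -> z = y.
    move=> zX; move/subsetP: Xs => /(_ z zX); rewrite !inE => /orP[/eqP //|zC].
    by have : z \in X :&: C; [rewrite inE zX|rewrite XC0 inE].
  have [z zX] := set0Pn _ X0; have zy := X1 z zX; rewrite {z}zy in zX.
  have xX : x \in X by apply: (Xcl y) => //; rewrite ?inE ?xC ?orbT// adj_sym.
  by have : x \in X :&: C; [rewrite inE xX|rewrite XC0 inE].
have CX : C \subset X.
  suff <- : X :&: C = C by exact: subsetIl.
  apply: cC => //; first exact: subsetIr.
  move=> a b; rewrite !inE => /andP[aX aC] bC ab; rewrite bC andbT.
  by apply: (Xcl a) => //; rewrite !inE bC orbT.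
apply/eqP; rewrite eqEsubset Xs subUset CX andbT sub1set.
by apply: (Xcl x) => //; [exact: (subsetP CX)|rewrite !inE eqxx].
Qed.

Lemma conn_exit B X : conn B -> X \subset B -> X != set0 -> X != B ->
  exists x y, [/\ x \in X, y \in B, y \notin X & adj x y].
Proof.
move=> cB XB X0 /eqP XnB; apply: contrapT => h; apply: XnB; apply: cB => //.
move=> x y xX yB xy; apply: contrapT => /negP yX; apply: h.
by exists x, y.
Qed.

(* Among all [v] in the complement of [A] next to [A], and all connected [C] in
   what is left of the complement, one with [C] largest exhausts the rest:
   otherwise another component of the rest touches [A] at some [w], and [C]
   together with [v] is connected and avoids [w]. *)
Lemma conn_transfer A :
  conn A -> conn (~: A) -> A != set0 ->
  (exists x y, [/\ x \in A, y \notin A & adj x y]) ->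
  (forall v, v \notin A -> conn (~: [set v]) \/
     forall a b c, adj v a -> adj v b -> adj v c -> [\/ a = b, a = c | b = c]) ->
  exists v, [/\ v \notin A, exists2 x, x \in A & adj x v,
    conn (v |: A) & conn (~: (v |: A))].
Proof.
move=> cA cB A0 [x0 [y0 [x0A y0A x0y0]]] hv.
pose P (p : T * {set T}) := `[< [/\ p.1 \notin A,
  exists2 x, x \in A & adj x p.1, p.2 \subset ~: (p.1 |: A) & conn p.2] >].
(* The empty set is vacuously [conn], so there is a pair to maximize over. *)
have P0 : P (y0, set0).
  apply/asboolP; split => //=; first by exists x0.
    exact: sub0set.
  by move=> X; rewrite subset0 => ->.
case: (@arg_maxnP _ (y0, set0) P (fun p => #|p.2|) P0) => -[v C].
move=> /asboolP[/= vA [x xA xv] CB cC] maxC.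
have vC : v \notin C.
  by apply: contraTN CB => vC; apply/subsetPn; exists v; rewrite // !inE eqxx.
exists v; split => //; [by exists x|exact: conn_setU1 xA xv|].
suff <- : C = ~: (v |: A) by [].
apply: contrapT => /eqP CnB.
have max' w C' : w \notin A -> (exists2 x, x \in A & adj x w) ->
    C' \subset ~: (w |: A) -> conn C' -> (#|C'| <= #|C|)%N.
  by move=> *; apply: (maxC (w, C')); apply/asboolP.
have CsA : C \subset ~: A.
  by apply: (subset_trans CB); rewrite setCS subsetUr.
(* Adding to [C] a neighbour outside [v |: A] would enlarge it, so [C] is a union of components of
   the rest; [D] collects the remaining cells. *)
have Ccl : closed_in (~: (v |: A)) C.
  move=> a b aC bB ab; apply: contrapT => /negP bC.
  have := max' v (b |: C) vA (ex_intro2 _ _ x xA xv).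
  rewrite subUset sub1set bB CB => /(_ isT (conn_setU1 cC aC ab)).
  by rewrite cardsU1 bC add1n ltnn.
pose D := ~: (v |: A) :\: C.
have D0 : D != set0.
  by rewrite setD_eq0; apply: contra CnB => ?; rewrite eqEsubset CB.
have DsA : D \subset ~: A.
  by apply: (subset_trans (subsetDl _ _)); rewrite setCS subsetUr.
have C0 : C != set0.
  apply/eqP => C0; have [d dD] := set0Pn _ D0.
  have := max' v [set d] vA (ex_intro2 _ _ x xA xv).
  rewrite sub1set; move: dD; rewrite inE => /andP[_ ->] /(_ isT (@conn1 d)).
  by rewrite cards1 C0 cards0.
have vB : v \in ~: A by rewrite inE.
(* The complement of [A] is connected, and within it [C] and [D] can be left only through [v]; so
   each of them has an edge to [v]. *)
have [c cC' cv] : exists2 c, c \in C & adj c v.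
  have [|c [y [cC' yA yC cy]]] := conn_exit cB CsA C0.
    by apply: contraNneq vC => ->.
  exists c => //; have [<- //|yv] := eqVneq y v.
  have := Ccl c y cC'; rewrite (negbTE yC) => /(_ _ cy) H; exfalso.
  by move: H; rewrite !inE in yA *; rewrite (negbTE yv) (negbTE yA) => /(_ isT).
have [d dD dv] : exists2 d, d \in D & adj d v.
  have [|d [y [dD yA yD dy]]] := conn_exit cB DsA D0.
    by apply/eqP => DA; move: vB; rewrite -DA !inE eqxx /= andbF.
  exists d => //; have [<- //|yv] := eqVneq y v.
  have yC : y \in C.
    by move: yD yA; rewrite !inE (negbTE yv) /= => + yA; rewrite yA andbT negbK.
  have dC : d \in C.
    apply: (Ccl y) => //; last by rewrite adj_sym.
    by move: dD; rewrite inE => /andP[].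
  by move: dD; rewrite inE dC.
(* The vertices [x], [c] and [d] lie in the disjoint sets [A], [C] and [D], so [v] has three
   distinct neighbours and the degree alternative fails. *)
have [cv'|deg] := hv v vA; last first.
  have := deg x c d; rewrite !(adj_sym v) => /(_ xv cv dv)[E|E|E].
  - by move: (subsetP CsA c cC'); rewrite -E inE xA.
  - by move: (subsetP DsA d dD); rewrite -E inE xA.
  - by move: dD; rewrite -E inE cC'.
(* An edge that leaves [D] and avoids [v] ends in [A]. Its start [w] then competes with [v], and
   [v |: C] is larger than [C]. *)
have [||w [a [wD av aD wa]]] := conn_exit cv' _ D0.
- by apply: (subset_trans (subsetDl _ _)); rewrite setCS subsetUl.
- apply/eqP => DE; move: (subsetP DsA x); rewrite DE !inE xA.
  by have [xv'|_ /(_ isT)//] := eqVneq x v; rewrite xv' (negbTE vA) in xA.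
have wA : w \notin A by move: (subsetP DsA w wD); rewrite inE.
have aA : a \in A.
  apply: contrapT => /negP aA; rewrite !inE in av.
  have aC : a \in C by move: aD; rewrite !inE (negbTE av) (negbTE aA) /= andbT negbK.
  have : w \in C.
    by apply: (Ccl a); rewrite // 1?adj_sym//; move: wD; rewrite inE => /andP[].
  by move: wD; rewrite inE => /andP[/negbTE ->].
have := max' w (v |: C) wA; rewrite cardsU1 vC add1n ltnn => H; exfalso.
apply/notF/H; first by exists a; rewrite // adj_sym.
  have wv : w != v by move: wD; rewrite !inE => /andP[_]; case: eqP.
  rewrite subUset sub1set !inE negb_or eq_sym wv vA /=.
  apply/subsetP => z zC; rewrite !inE negb_or.
  move: (subsetP CsA z zC); rewrite inE => ->; rewrite andbT.
  by apply: contraTneq wD => <-; rewrite inE zC.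
exact: conn_setU1 cC cC' cv.
Qed.

End graph_connectedness.

From mathcomp Require Import all_boot all_order all_algebra.
From mathcomp Require Import lra.
From mathcomp Require Import all_classical all_reals all_analysis.
From mathcomp Require Import measurable_realfun.

Import Order.TTheory GRing.Theory Num.Theory.
Import numFieldNormedType.Exports.

Local Open Scope classical_set_scope.
Local Open Scope ring_scope.

(** * Continuous functions and connected pieces of arcs *)

Section topology_of_networks.
Context {R : realType} {Q : network R}.
Implicit Types (x y : npoint Q) (e : arcs Q) (B S T : set (npoint Q)).

Lemma nbhs_path_dist x (A : set (npoint Q)) (eps : R) : 0 < eps ->
  (forall y, path_dist x y < eps -> A y) -> nbhs x A.
Proof. by move=> eps0 xA; apply/nbhs_ballP; exists eps. Qed.

(** Open and closed sets of the network are obtained below as preimages of half-lines under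
    functions given by such a formula on each closed arc. *)
Lemma path_dist_lipschitz_continuous (f : npoint Q -> R) (g : arcs Q -> R -> R) :
  (forall e t, 0 <= t <= len e -> f (arc_point e t) = g e t) ->
  (forall e s t, g e t - g e s <= `|s - t|) ->
  continuous f.
Proof.
move=> fg lip x A /nbhs_ballP[eps /= eps0 xA].
apply: (nbhs_path_dist eps0) => y xy; apply: xA.
apply: le_lt_trans xy; rewrite -[leLHS]/(`|f x - f y|).
have xy := path_dist_lipschitz x y fg lip.
have yx := path_dist_lipschitz y x fg lip; rewrite path_dist_sym in yx.
by rewrite ler_norml; apply/andP; split; lra.
Qed.

Lemma arc_point_le0 e t : t <= 0 -> arc_point e t = Node (src e).
Proof.
move=> t0; rewrite /arc_point; case: {-}_ / idP => h; last by rewrite t0.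
by exfalso; move: h; rewrite ltNge t0.
Qed.

Lemma arc_point_ge_len e t : len e <= t -> arc_point e t = Node (tgt e).
Proof.
move=> tl; rewrite /arc_point; case: {-}_ / idP => h.
  by exfalso; move: h; rewrite (ltNge t) tl andbF.
by rewrite leNgt (lt_le_trans (len_gt0 e)).
Qed.

(** The map factors through clamping to [[0, len e]], which is 1-Lipschitz; between clamped
    coordinates, the segment of the arc bounds the distance. *)
Lemma arc_point_continuous e : continuous (arc_point e : R -> npoint Q).
Proof.
pose clamp (s : R) : R := Num.max 0 (Num.min s (len e)).
have l0 := len_gt0 e.
have clamp0 s : 0 <= clamp s <= len e.
  by rewrite /clamp le_max lexx ge_max ge_min lexx orbT andbT /= ltW.
have clampE s : arc_point e (clamp s) = arc_point e s.
  have [s0|s0] := leP s 0.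
    have -> : clamp s = 0 by rewrite /clamp min_l ?max_l//; lra.
    by rewrite arc_point0 arc_point_le0.
  have [sl|/ltW sl] := leP (len e) s.
    have -> : clamp s = len e by rewrite /clamp min_r ?max_r//; lra.
    by rewrite arc_point_len arc_point_ge_len.
  by congr arc_point; rewrite /clamp min_l ?max_r // ltW.
move=> s A /nbhs_ballP[eps /= eps0 sA].
apply/nbhs_ballP; exists eps => //= t st; apply: sA.
apply: le_lt_trans st; rewrite -[leLHS]/(path_dist _ _) -!(clampE s) -(clampE t).
apply: (@le_trans _ _ `|clamp s - clamp t|).
  exact/path_dist_le/path_length_arc.
have := ler_norm (s - t); have := ler_norm (t - s); rewrite (distrC t s) => ? ?.
rewrite /clamp !(maxEle,minEle) ler_norml; apply/andP.
by split; repeat case: ifPn; rewrite -?ltNge => *; lra.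
Qed.

Lemma connected_arc_point e (i : interval R) :
  connected (arc_point e @` [set` i]).
Proof.
apply: connected_continuous_connected.
  apply/connected_intervalP; exact: interval_is_interval.
exact/continuous_subspaceT/arc_point_continuous.
Qed.

Lemma connected_src_arc e (s : R) :
  connected (Node (src e) |` arc_point e @` `]0, s[).
Proof.
have [s0|s0] := leP s 0.
  by rewrite set_itv_ge ?bnd_simp -?leNgt// image_set0 setU0; exact: connected1.
have -> : Node (src e) |` arc_point e @` `]0, s[ = arc_point e @` `[0, s[.
  rewrite -(@setU1itv _ _ _ 0 false) ?bnd_simp//.
  by rewrite image_setU image_set1 arc_point0.
exact: connected_arc_point.
Qed.

Lemma connected_tgt_arc e (s : R) :
  connected (Node (tgt e) |` arc_point e @` `]s, len e[).
Proof.
have [s0|s0] := leP (len e) s.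
  by rewrite set_itv_ge ?bnd_simp -?leNgt// image_set0 setU0; exact: connected1.
have -> : Node (tgt e) |` arc_point e @` `]s, len e[ = arc_point e @` `]s, len e].
  rewrite -(@setUitv1 _ _ _ (len e) true) ?bnd_simp//.
  by rewrite image_setU image_set1 arc_point_len setUC.
exact: connected_arc_point.
Qed.

(** These are the two conditions that [connected] imposes on a nonempty part of [S] before
    concluding that it is all of [S]. *)
Definition relative_clopen (T : topologicalType) (S B : set T) :=
  (exists2 C, open C & B = S `&` C) /\ (exists2 C, closed C & B = S `&` C).

Lemma connected_sub_clopen (X : topologicalType) (S B T : set X) :
  relative_clopen S B -> connected T -> T `<=` S -> T `&` B !=set0 -> T `<=` B.
Proof.
move=> [[C oC BC] [D cD BD]] cT TS TB.
suff -> : T = T `&` B by exact: subIsetr.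
symmetry; apply: cT => //.
- exists C => //; rewrite BC setIA; congr (_ `&` _); exact/setIidPl.
- exists D => //; rewrite BD setIA; congr (_ `&` _); exact/setIidPl.
Qed.

End topology_of_networks.

(** * Traces of connected sets on arcs *)

Section connected_sets_on_arcs.
Context {R : realType} {Q : network R}.
Implicit Types (x y : npoint Q) (e : arcs Q) (S : set (npoint Q)).

(* The function [f] below is Lipschitz, positive exactly between [c1] and [c2],
   and zero only at these two points, so it has a constant sign on [S]. *)
Lemma connected_sub_arc e S (c1 b c2 : R) : connected S ->
  0 < c1 -> c1 < b < c2 -> c2 < len e ->
  ~ S (arc_point e c1) -> S (arc_point e b) -> ~ S (arc_point e c2) ->
  forall t, 0 < t < len e -> S (arc_point e t) -> c1 < t < c2.
Proof.
move=> cS c10 /andP[c1b bc2] c2l Sc1 Sb Sc2.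
(* Truncating at [- m] makes [g] equal to [- m] at both ends of [e], in agreement with the value of
   [f] at all nodes and on the other arcs. *)
pose m := Num.min c1 (len e - c2).
have m0 : 0 < m by rewrite lt_min c10 subr_gt0.
have mc1 : m <= c1 by rewrite ge_min lexx.
have mc2 : m <= len e - c2 by rewrite ge_min lexx orbT.
pose g e' t : R := if e' == e then Num.max (- m) (Num.min (t - c1) (c2 - t))
  else - m.
pose f x := match x with Node _ => - m | Inner e' t _ => g e' t end.
have fg e' t : 0 <= t <= len e' -> f (arc_point e' t) = g e' t.
  move=> te; case: (arc_pointP te) => //= et; rewrite /g et.
    case: ifPn => // _.
    by rewrite max_l// ge_min sub0r lerN2 mc1.
  case: ifPn => // /eqP ->.
  by rewrite max_l// ge_min (_ : c2 - len e <= - m) ?orbT//; lra.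
have cf : continuous f.
  apply: path_dist_lipschitz_continuous fg _ => e' s t; rewrite /g.
  have := ler_norm (s - t); have := ler_norm (t - s); rewrite (distrC t s) => ? ?.
  case: ifPn => _; last lra.
  by rewrite !(maxEle,minEle); repeat case: ifPn; rewrite -?ltNge => *; lra.
(* The zeros of [f] are the points at [c1] and [c2], which [S] avoids; hence the part of [S] where
   [f] is positive is both open and closed in [S]. *)
have f0 x : S x -> (0 <= f x) = (0 < f x).
  rewrite le_eqVlt; have [fx0 Sx|//] := eqVneq 0 (f x); exfalso.
  case: x fx0 Sx => [u|e' t h] /=; first by move=> *; lra.
  rewrite /g; case: ifPn => [/eqP ee|_]; last by move=> *; lra.
  subst e'; rewrite -(arc_point_inner h) => mx St.
  have [tc|tc] : t = c1 \/ t = c2.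
    move: mx; rewrite !(maxEle,minEle); repeat case: ifPn; rewrite -?ltNge => *;
      first [by left; lra|by right; lra|lra].
  - by apply: Sc1; rewrite -tc.
  - by apply: Sc2; rewrite -tc.
have SE : S `&` [set x | 0 < f x] = S.
  apply: cS.
  - exists (arc_point e b); split => //=; rewrite fg ?/g ?eqxx; last lra.
    by rewrite lt_max lt_min; apply/orP; right; apply/andP; split; lra.
  - exists [set x | 0 < f x] => //.
    have -> : [set x | 0 < f x] = f @^-1` [set r | 0 < r] by [].
    by apply: open_comp; [move=> *; exact: cf|exact: open_gt].
  - exists [set x | 0 <= f x].
      have -> : [set x | 0 <= f x] = f @^-1` [set r | 0 <= r] by [].
      by apply: closed_comp; [move=> *; exact: cf|exact: closed_ge].
    by apply/seteqP; split=> x [Sx /=]; rewrite -f0.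
move=> t /andP[t0 tl]; rewrite -{1}SE => -[_ /=]; rewrite fg ?ltW ?t0//.
rewrite /g eqxx lt_max lt_min => /orP[|/andP[]]; lra.
Qed.

Definition arc_trace e S : set R := `]0%R, len e[ `&` (arc_point e @^-1` S).

(* Either the trace of a connected set on an arc is an interval, or its
   complement in the arc is one. *)
Lemma arc_trace_measurable e S : connected S -> measurable (arc_trace e S).
Proof.
move=> cS; have mI : measurable (`]0%R, len e[%classic : set R) by [].
have [/is_interval_measurable//|nitv] := pselect (is_interval (arc_trace e S)).
suff : is_interval (`]0%R, len e[ `\` arc_trace e S).
  move=> /is_interval_measurable mD.
  have -> : arc_trace e S = `]0%R, len e[ `\` (`]0%R, len e[ `\` arc_trace e S).
    by rewrite setDD; apply/seteqP; split=> t; rewrite /arc_trace /=; tauto.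
  exact: measurableD.
(* The trace contains some [a] and [b] with a missing [c] between them. A hole in the complement
   will be a point [d] of the trace between missing points [c1] and [c2]. *)
move: nitv => /existsNP[a /existsNP[b /not_implyP[[]]]].
rewrite /= in_itv/= => /andP[a0 al] Sa /not_implyP[[]].
rewrite /= in_itv/= => /andP[b0 bl] Sb /existsNP[c /not_implyP[/andP[ac cb] nc]].
have ltac : a < c.
  rewrite lt_neqAle ac andbT; apply/eqP => ac'; apply: nc.
  by rewrite -ac'; split; rewrite //= in_itv/= a0.
have ltcb : c < b.
  rewrite lt_neqAle cb andbT; apply/eqP => cb'; apply: nc.
  by rewrite cb'; split; rewrite //= in_itv/= b0.
have Sc : ~ S (arc_point e c).
  by move=> Sc; apply: nc; split => //; rewrite /= in_itv/=; apply/andP; split; lra.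
move=> c1 c2 [/=]; rewrite in_itv/= => /andP[c10 c1l] nc1.
move=> [/=]; rewrite in_itv/= => /andP[c20 c2l] nc2 d /andP[c1d dc2].
have d0l : 0 < d < len e by apply/andP; split; lra.
split; first by rewrite /= in_itv.
move=> [_ Sd].
have Sc1 : ~ S (arc_point e c1).
  by move=> h; apply: nc1; split; rewrite //= in_itv/= c10.
have Sc2 : ~ S (arc_point e c2).
  by move=> h; apply: nc2; split; rewrite //= in_itv/= c20.
have ltc1d : c1 < d.
  by rewrite lt_neqAle c1d andbT; apply/eqP => E; apply: Sc1; rewrite E.
have ltdc2 : d < c2.
  by rewrite lt_neqAle dc2 andbT; apply/eqP => E; apply: Sc2; rewrite -E.
(* The trace is confined between [c1] and [c2], so [c1 < a < c]. This confines it between [c1] and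
   [c] as well, contrary to [c < b]. *)
have sub := @connected_sub_arc e S c1 d c2 cS c10 _ c2l Sc1 Sd Sc2.
have /andP[c1a ac2] : c1 < a < c2 by apply: sub; rewrite ?a0 ?ltc1d ?ltdc2.
have /andP[c1b bc2] : c1 < b < c2 by apply: sub; rewrite ?b0 ?ltc1d ?ltdc2.
have := @connected_sub_arc e S c1 a c cS c10.
rewrite c1a ltac (lt_trans ltcb bl) => /(_ isT isT Sc1 Sa Sc b).
by rewrite b0 bl => /(_ isT Sb)/andP[_]; rewrite ltNge (ltW ltcb).
Qed.

End connected_sets_on_arcs.

(** * Unions of cells: graph connectedness against topological connectedness *)

Section cells.
Context {R : realType} {Q : network R}.
Implicit Types (x y : npoint Q) (e : arcs Q) (u v : nodes Q).

Definition cell : finType := (nodes Q + arcs Q)%type.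

Definition cell_of x : cell :=
  match x with Node u => inl u | Inner e _ _ => inr e end.

Definition points (A : {set cell}) : set (npoint Q) := [set x | cell_of x \in A].

Definition incident e u := (src e == u) || (tgt e == u).

(** This is the bipartite incidence graph: an arc is adjacent only to its end nodes, hence has at
    most two neighbours, even when arcs are parallel. *)
Definition cell_adj (a b : cell) := match a, b with
  | inl u, inr e | inr e, inl u => incident e u
  | _, _ => false end.

Lemma cell_adj_sym : symmetric cell_adj.
Proof. by move=> [u|e] [v|e']. Qed.

Lemma incident_src e : incident e (src e). Proof. by rewrite /incident eqxx. Qed.

Lemma incident_tgt e : incident e (tgt e).
Proof. by rewrite /incident eqxx orbT. Qed.

Lemma cell_of_arc_point e t : 0 < t < len e -> cell_of (arc_point e t) = inr e.
Proof. by move=> h; rewrite (arc_point_inner h). Qed.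

Lemma cell_nonempty (c : cell) : exists x, cell_of x = c.
Proof.
case: c => [u|e]; first by exists (Node u).
have h : 0 < len e / 2 < len e by have ? := len_gt0 e; apply/andP; split; lra.
by exists (Inner h).
Qed.

Lemma pointsS (A B : {set cell}) : A \subset B -> points A `<=` points B.
Proof. by move=> /fintype.subsetP AB x; exact: AB. Qed.

Lemma points_inj (A B : {set cell}) : points A = points B -> A = B.
Proof.
move=> AB; apply/setP => c; have [x <-] := cell_nonempty c.
apply/idP/idP; first by rewrite -[is_true _]/(points A x) AB.
by rewrite -[is_true _]/(points B x) -AB.
Qed.

Lemma points_node u : points [set inl u]%SET = [set Node u].
Proof.
apply/seteqP; split=> x; rewrite /points /= inE; last by move=> ->.
by case: x => [v|e t h] //= /eqP[->].
Qed.

Lemma points_arc e : points [set inr e]%SET = arc_point e @` `]0, len e[.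
Proof.
apply/seteqP; split=> x; rewrite /points /= inE.
  case: x => [v|e' t h] //= /eqP[ee]; subst e'.
  by exists t; rewrite ?arc_point_inner //= in_itv.
by move=> [t]; rewrite /= in_itv/= => te <-; rewrite cell_of_arc_point.
Qed.

Lemma points_setU (A B : {set cell}) : points (A :|: B)%SET = points A `|` points B.
Proof.
apply/seteqP; split=> x; rewrite /points /= inE; first by move=> /orP.
by move=> h; apply/orP.
Qed.

Lemma connected_cell (c : cell) : connected (points [set c]%SET).
Proof.
case: c => [u|e]; first by rewrite points_node; exact: connected1.
by rewrite points_arc; exact: connected_arc_point.
Qed.

Lemma connected_cell_adj (a b : cell) :
  cell_adj a b -> connected (points [set a; b]%SET).
Proof.
wlog [u [e [-> ->]]] : a b / exists u e, a = inl u /\ b = inr e.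
  move=> H; case: a b => [u|e] [v|e'] //= h.
    by apply: (H (inl u) (inr e')) => //; exists u, e'.
  by rewrite finset.setUC; apply: (H (inl v) (inr e)) => //; exists v, e.
rewrite points_setU points_node points_arc => /orP[/eqP <-|/eqP <-].
  exact: connected_src_arc.
exact: connected_tgt_arc.
Qed.

(** A relatively clopen part contains every cell that it meets, since cells are connected. It then
    meets all adjacent cells in [A], since two adjacent cells have a connected union; so the cells
    that it meets are closed under adjacency. *)
Lemma conn_connected (A : {set cell}) : conn cell_adj A -> connected (points A).
Proof.
move=> cA B B0 oB dB.
have clB : relative_clopen (points A) B by [].
have BA : B `<=` points A by case: oB => C _ ->; exact: subIsetl.
pose X := [set c in A | `[< points [set c]%SET `&` B !=set0 >]]%SET.
have sub c : c \in A -> points [set c]%SET `<=` points A.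
  by move=> cA'; apply: pointsS; rewrite finset.sub1set.
have XB c : c \in X -> points [set c]%SET `<=` B.
  rewrite inE => /andP[cA' /asboolP cB].
  exact: (connected_sub_clopen clB (@connected_cell c) (sub c cA') cB).
have selfpt x : points [set cell_of x]%SET x by rewrite /points /= inE.
suff XA : X = A.
  apply/seteqP; split=> // x xA; apply: (XB (cell_of x)) => //.
  by rewrite XA.
apply: cA.
- by apply/fintype.subsetP => c; rewrite inE => /andP[].
- have [x Bx] := B0; apply/finset.set0Pn; exists (cell_of x); rewrite inE.
  by apply/andP; split; [exact: BA|apply/asboolP; exists x].
- move=> a b aX bA ab; rewrite inE bA; apply/asboolP.
  have aA : a \in A by move: aX; rewrite inE => /andP[].
  have [x xa] := cell_nonempty a; have [y yb] := cell_nonempty b.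
  exists y; split; first by rewrite -yb.
  apply: (connected_sub_clopen clB (@connected_cell_adj a b ab)).
  + by apply: pointsS; rewrite finset.subUset !finset.sub1set aA bA.
  + exists x; split; first by rewrite /points /= !inE xa eqxx.
    by apply: (XB a) => //; rewrite -xa.
  + by rewrite /points /= !inE yb eqxx orbT.
Qed.

(** The set is where a Lipschitz function is positive: on an arc of [X] it is the distance along the
    arc to the ends outside [X], capped at a constant [m]; it is [m] at the nodes of [X] and zero
    off [X]. *)
Lemma points_open (X : {set cell}) :
  (forall u e, inl u \in X -> incident e u -> inr e \in X) -> open (points X).
Proof.
move=> Xinc.
(* With [m] at most every arc length, the value at a node of [X] is [m] even if the other end of the
   arc lies outside [X]. *)
have [m m0 mlen] : exists2 m : R, 0 < m & forall e, m <= len e.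
  exists (\big[Num.min/1]_(e : arcs Q) len e).
    by elim/big_ind: _ => // [x y x0 y0|e _]; rewrite ?lt_min ?x0 ?len_gt0.
  by move=> e; exact: bigmin_le_cond.
pose g e t : R := if inr e \in X then
  Num.min m (Num.min (if inl (src e) \in X then m else t)
                     (if inl (tgt e) \in X then m else len e - t)) else 0.
pose f x := match x with
  Node u => if inl u \in X then m else 0 | Inner e t _ => g e t end.
have fg e t : 0 <= t <= len e -> f (arc_point e t) = g e t.
  have ml := mlen e.
  move=> te; case: (arc_pointP te) => //= et; rewrite /g et.
    have [sX|sX] := boolP (inl (src e) \in X).
      rewrite (Xinc _ _ sX (incident_src e)) min_l// le_min lexx.
      by case: ifP; rewrite ?subr0 ?lexx.
    case: ifP => // _; rewrite [Num.min 0 _]min_l; first by rewrite min_r ?ltW.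
    by case: ifP => _; rewrite ?subr0 ltW ?len_gt0.
  have [sX|sX] := boolP (inl (tgt e) \in X).
    rewrite (Xinc _ _ sX (incident_tgt e)) min_l// le_min lexx andbT.
    by case: ifP; rewrite ?lexx.
  case: ifP => // _; rewrite subrr (@min_r _ _ _ 0); first by rewrite min_r ?ltW.
  by case: ifP => _; rewrite ltW ?len_gt0.
have cf : continuous f.
  apply: path_dist_lipschitz_continuous fg _ => e s t; rewrite /g.
  have := ler_norm (s - t); have := ler_norm (t - s); rewrite (distrC t s) => ? ?.
  case: ifPn => [_|_]; last lra.
  by case: ifPn => [_|_]; case: ifPn => [_|_]; rewrite !minEle; repeat case: ifPn;
    rewrite -?ltNge => *; lra.
have -> : points X = f @^-1` [set r | 0 < r].
  apply/seteqP; split=> -[u|e t h]; rewrite /points /=; try case/andP: (h) => t0 tl.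
  - by move=> ->.
  - by rewrite /g => ->; rewrite !lt_min m0; do 2 (case: ifP => _); rewrite ?subr_gt0 ?m0 ?t0 ?tl.
  - by case: ifP; rewrite // ltxx.
  - by rewrite /g; case: ifP; rewrite // ltxx.
by apply: open_comp; [move=> *; exact: cf|exact: open_gt].
Qed.

(** If [X] is closed under adjacency away from [u], then both [X] and the remaining cells [Y]
    contain every arc incident to one of their nodes. Both unions of cells are therefore open, which
    makes [points X] relatively clopen. *)
Lemma two_connected_conn u :
  two_connected Q -> conn cell_adj (~: [set inl u])%SET.
Proof.
move=> /(_ u) cu X Xu X0 Xcl.
have ptC : points (~: [set inl u])%SET = ~` [set Node u].
  rewrite -points_node; apply/seteqP; split=> x; rewrite /points /= !inE.
    by move=> /negP.
  by move=> h; apply/negP.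
pose Y := (~: [set inl u] :\: X)%SET.
have oX : open (points X).
  apply: points_open => v e vX ev; apply: (Xcl (inl v)) => //.
  by rewrite !inE.
have oY : open (points Y).
  apply: points_open => v e; rewrite !inE => /andP[vX vu] ev.
  rewrite andbT; apply: contra vX => eX.
  by apply: (Xcl (inr e)); rewrite // !inE.
apply: points_inj; rewrite ptC; apply: cu.
- by have [c cX] := finset.set0Pn _ X0; have [x xc] := cell_nonempty c;
    exists x; rewrite /points /= xc.
- by exists (points X) => //; rewrite setIidr// -ptC; exact: pointsS.
- exists (~` points Y); first exact: open_closedC.
  rewrite -ptC; apply/seteqP; split=> x; rewrite /points /= !inE.
    by move=> xX; split; [move: (fintype.subsetP Xu _ xX); rewrite !inE|rewrite xX].
  by move=> [-> /negP]; rewrite andbT negbK.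
Qed.

End cells.

Arguments cell {R} Q.

(** * Two disjoint connected sets of length at least one half *)

Section lengths.
Context {R : realType} {Q : network R}.
Implicit Types (x y : npoint Q) (e : arcs Q) (u v : nodes Q) (S : set (npoint Q)).

Lemma lebesgue_measure_oo (a b : R) : a <= b ->
  lebesgue_measure (`]a, b[%classic : set R) = (b - a)%:E.
Proof.
move=> ab; rewrite lebesgue_measure_itv/= lte_fin; case: ltP => [_|ba].
  by rewrite -EFinB.
by have -> : a = b by [apply/eqP; rewrite eq_le ab]; rewrite subrr.
Qed.

Lemma length_measure_ge S (F : arcs Q -> set R) :
  connected S -> (forall e, measurable (F e)) ->
  (forall e t, F e t -> 0 < t < len e /\ S (arc_point e t)) ->
  (\sum_(e : arcs Q) lebesgue_measure (F e) <= length_measure S)%E.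
Proof.
move=> cS mF FS; apply: lee_sum => e _; apply: le_measure.
- by rewrite inE; exact: mF.
- by rewrite inE; exact: arc_trace_measurable.
- by move=> t /FS[te St]; split => //; rewrite /= in_itv.
Qed.

Definition total_len (A : {set cell Q}) : R := \sum_(e | inr e \in A) len e.

Lemma length_measure_points_ge (A : {set cell Q}) e (H : interval R) :
  inr e \notin A -> [set` H] `<=` `]0, len e[ ->
  connected (points A `|` arc_point e @` [set` H]) ->
  ((total_len A)%:E + lebesgue_measure [set` H] <=
     length_measure (points A `|` arc_point e @` [set` H]))%E.
Proof.
move=> eA He cS.
pose F e' : set R := if e' == e then [set` H]
  else if inr e' \in A then `]0, len e'[%classic else set0.
have FS e' t : F e' t -> 0 < t < len e' /\
    (points A `|` arc_point e @` [set` H]) (arc_point e' t).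
  rewrite /F; case: ifPn => [/eqP ->|_].
    move=> Ht; split; first by have := He _ Ht; rewrite /= in_itv.
    by right; exists t.
  case: ifPn => // e'A; rewrite /= in_itv/= => te; split=> //; left.
  by rewrite /points /= cell_of_arc_point.
have mF e' : measurable (F e') by rewrite /F; case: ifP => // _; case: ifP.
apply: le_trans (length_measure_ge cS mF FS).
rewrite (bigD1 e)//= {1}/F eqxx addeC leeD2l// /total_len -sumEFin big_mkcond /=.
rewrite [in leLHS](bigD1 e)//= (negbTE eA) add0e; apply: lee_sum => e' e'e.
rewrite /F (negbTE e'e); case: ifP => _; last by rewrite measure0.
by rewrite lebesgue_measure_oo ?subr0// ltW ?len_gt0.
Qed.

(** The arc is cut at distance [r] from its end [u], and [w] is the other end, equal to [u] for a
    loop. The pieces [H] and [K] omit the cut point, which has measure zero, and one of them is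
    empty when [r] is [0] or [len e]. *)
Lemma arc_cut e u (r : R) : incident e u -> 0 <= r <= len e ->
  exists (w : nodes Q) (H K : interval R),
  [/\ forall v, incident e v -> v = u \/ v = w,
      [/\ [set` H] `<=` `]0, len e[, [set` K] `<=` `]0, len e[ &
        [set` H] `&` [set` K] = set0],
      lebesgue_measure ([set` H] : set R) = r%:E /\
      lebesgue_measure ([set` K] : set R) = (len e - r)%:E,
      connected (Node u |` arc_point e @` [set` H]) &
      connected (Node w |` arc_point e @` [set` K])].
Proof.
have disj (s : R) : `]0, s[ `&` `]s, len e[ = set0 :> set R.
  by rewrite -subset0 => t [] /=; rewrite !in_itv/=; lra.
have sub0 (s : R) : s <= len e -> `]0, s[ `<=` `]0, len e[.
  by move=> sl t /=; rewrite !in_itv/= => /andP[-> /lt_le_trans]; exact.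
have subl (s : R) : 0 <= s -> `]s, len e[ `<=` `]0, len e[.
  by move=> s0 t /=; rewrite !in_itv/= => /andP[/(le_lt_trans s0) -> ->].
move=> /orP[/eqP <-|/eqP <-] /andP[r0 rl].
  exists (tgt e), `]0, r[, `]r, len e[; split=> //.
  - by move=> v /orP[/eqP <-|/eqP <-]; [left|right].
  - by split; [exact: sub0|exact: subl|].
  - by rewrite !lebesgue_measure_oo// subr0.
  - exact: connected_src_arc.
  - exact: connected_tgt_arc.
exists (src e), `]len e - r, len e[, `]0, len e - r[; split=> //.
- by move=> v /orP[/eqP <-|/eqP <-]; [right|left].
- by split; [apply: subl; lra|apply: sub0; lra|rewrite setIC].
- by rewrite !lebesgue_measure_oo ?subr0 ?opprB; [split; congr EFin; lra|lra..].
- exact: connected_tgt_arc.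
- exact: connected_src_arc.
Qed.

Lemma connected_points_arc (A : {set cell Q}) e u (H : interval R) :
  connected (points A) -> inl u \in A ->
  connected (Node u |` arc_point e @` [set` H]) ->
  connected (points A `|` arc_point e @` [set` H]).
Proof.
move=> cA uA cH.
have -> : points A `|` arc_point e @` [set` H] =
    points A `|` (Node u |` arc_point e @` [set` H]).
  by rewrite setUA; congr (_ `|` _); apply/esym/setUidPl => _ ->.
by apply: connectedU => //; exists (Node u); split => //; left.
Qed.

(** Otherwise [A] would be closed under adjacency, and following paths of the connected graph from
    [u] it would contain all nodes, hence all arcs. *)
Lemma arcs_reach (A : {set cell Q}) u : inl u \in A ->
  A != [set: cell Q]%SET -> exists x y : cell Q, [/\ x \in A, y \notin A & cell_adj x y].
Proof.
move=> uA An; apply: contrapT => none.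
have clos (x y : cell Q) : x \in A -> cell_adj x y -> y \in A.
  by move=> xA xy; apply: contrapT => /negP yA; apply: none; exists x, y.
have node v : inl v \in A.
  have /connectP[p] := graph_connected u v.
  elim: p u uA => [|w p IH] u uA /=; first by move=> _ ->.
  move=> /andP[/existsP[e uw] wp]; apply: (IH w) => //.
  have /andP[eu ew] : incident e u && incident e w.
    by case/orP: uw => /andP[/eqP <- /eqP <-]; rewrite incident_src incident_tgt.
  exact: (clos (inr e) (inl w) (clos (inl u) (inr e) uA eu) ew).
move/eqP: An; apply; apply/setP => -[v|e]; rewrite inE ?node//.
exact: (clos (inl (src e)) (inr e) (node _) (incident_src e)).
Qed.

Lemma length_measure_setT :
  length_measure [set: npoint Q] = (\sum_(e : arcs Q) len e)%:E.
Proof.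
rewrite -sumEFin; apply: eq_bigr => e _.
by rewrite preimage_setT setIT lebesgue_measure_oo ?subr0// ltW ?len_gt0.
Qed.

Lemma arc_exists :
  length_measure [set: npoint Q] = 1%:E -> inhabited (arcs Q).
Proof.
rewrite length_measure_setT => -[len1]; apply: contrapT => none.
by move/eqP: len1; rewrite big1 1?eq_sym ?oner_eq0// => e; case: none.
Qed.

(* The cells are added to [A] one by one; when the length passes one half,
   the last cell added is an arc, and this arc is cut at the right place. *)
Lemma connected_halves :
  length_measure [set: npoint Q] = 1%:E -> two_connected Q ->
  exists S1 S2, [/\ connected S1, connected S2, S1 `&` S2 = set0,
    ((1 / 2)%:E <= length_measure S1)%E & ((1 / 2)%:E <= length_measure S2)%E].
Proof.
move=> lenQ Q2; have [e0] := arc_exists lenQ.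
move: lenQ; rewrite length_measure_setT => -[len1].
have lenE (A : {set cell Q}) : total_len A + total_len (~: A)%SET = 1.
  rewrite -len1 [RHS](bigID (fun e => inr e \in A))/=; congr (_ + _).
  by apply: eq_bigl => e; rewrite inE.
pose u0 := src e0.
pose P (A : {set cell Q}) := `[< [/\ inl u0 \in A, conn cell_adj A,
  conn cell_adj (~: A)%SET & total_len A <= 1 / 2] >].
have P0 : P [set inl u0]%SET.
  apply/asboolP; split; [by rewrite inE|exact: conn1|exact: two_connected_conn|].
  by rewrite /total_len big1 ?divr_ge0// => e; rewrite inE.
case: (@arg_maxnP _ [set inl u0]%SET P (fun A : {set cell Q} => #|A|) P0) => A.
move=> /asboolP[uA cA cB lA] maxA.
have AT : A != [set: cell Q]%SET.
  apply/eqP => AT; have := lenE A; rewrite {2}AT finset.setCT /total_len.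
  rewrite [X in _ + X]big1 => [|e]; last by rewrite inE.
  by move: lA; rewrite /total_len; lra.
have A0 : A != finset.set0 by apply/finset.set0Pn; exists (inl u0).
have deg (v : cell Q) : v \notin A -> conn cell_adj (~: [set v])%SET \/
    forall a b c, cell_adj v a -> cell_adj v b -> cell_adj v c ->
      [\/ a = b, a = c | b = c].
  case: v => [v|e] _; [by left; exact: two_connected_conn|right].
  move=> [a|//] [b|//] [c|//] /= /orP[] /eqP <- /orP[] /eqP <- /orP[] /eqP <-;
    by [constructor 1|constructor 2|constructor 3].
have [v [vA [x xA xv] cvA cvB]] :=
  conn_transfer cell_adj_sym cA cB A0 (arcs_reach uA AT) deg.
(* By maximality of [A], the set [v |: A] violates [P], and only the length bound can fail. *)
have lv : 1 / 2 < total_len (v |: A)%SET.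
  rewrite ltNge; apply/negP => lv.
  have := maxA (v |: A)%SET; rewrite /= cardsU1 vA add1n ltnn => H.
  apply/notF/H/asboolP; split=> //; by rewrite !inE uA orbT.
(* Adding a node would leave the length unchanged, so [v] is an arc. *)
case: v => [v|e] in vA xv cvA cvB lv.
  move: lv lA; rewrite /total_len (eq_bigl (fun e => inr e \in A)) => [|e].
    by lra.
  by rewrite !inE.
have lv' : total_len (inr e |: A)%SET = len e + total_len A.
  rewrite /total_len (bigD1 e) ?inE ?eqxx//=; congr (_ + _); apply: eq_bigl => e'.
  rewrite !inE -[inr e' == inr e]/(e' == e).
  by have [->|_] := eqVneq e' e; rewrite ?(negbTE vA) ?andbT.
case: x xA xv => [u|//] uA' eu; rewrite /= in eu.
(* This is the length that [A] lacks to reach one half. *)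
pose r := 1 / 2 - total_len A.
have rl : 0 <= r <= len e by rewrite /r; apply/andP; split; lra.
have [w [H [K [ew [He Ke HK] [lH lK] cH cK]]]] := arc_cut eu rl.
pose B := (~: (inr e |: A))%SET.
have cS1 : connected (points A `|` arc_point e @` [set` H]).
  by apply: connected_points_arc uA' cH; exact: conn_connected.
have cS2 : connected (points B `|` arc_point e @` [set` K]).
  (* If [w] is not in [B], then [B] is empty: the complement of [A] is [B] together with [e] and is
     connected, so a nonempty [B] would contain an end of [e], whereas [u] is in [A]. The second set
     is then the piece [K] alone. *)
  have [wB|wB] := boolP (inl w \in B).
    by apply: connected_points_arc wB cK; exact: conn_connected.
  suff -> : B = finset.set0.
    have -> : points finset.set0 = set0 :> set (npoint Q).
      by rewrite -subset0 => x; rewrite /points /= inE.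
    by rewrite set0U; exact: connected_arc_point.
  apply: contrapT => /eqP B0.
  have BA : B \subset (~: A)%SET by rewrite finset.setCS finset.subsetUr.
  have [|a [b [aB bA bB ab]]] := conn_exit cB BA B0.
    by apply/eqP => /setP/(_ (inr e)); rewrite !inE eqxx (negbTE vA).
  have be : b = inr e.
    by move: bA bB; rewrite !inE negbK => /negbTE ->; rewrite orbF => /eqP.
  case: a aB ab => [a|a] aB; rewrite be //= => /ew[E|E]; subst a.
    by move: aB; rewrite !inE uA'.
  by rewrite aB in wB.
exists (points A `|` arc_point e @` [set` H]),
  (points B `|` arc_point e @` [set` K]).
have inHe (i : interval R) t : [set` i] `<=` `]0, len e[ -> [set` i] t -> 0 < t < len e.
  by move=> ie /ie; rewrite /= in_itv.
split=> //.
- rewrite -subset0 => z [[zA|[s Hs <-]] [zB|[t Kt tz]]].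
  + by move: zB; rewrite /points /= !inE negb_or (_ : _ \in A)// andbF.
  + move: zA; rewrite -tz /points /= cell_of_arc_point ?(negbTE vA)//.
    exact: inHe Kt.
  + move: zB; rewrite /points /= cell_of_arc_point ?inE ?eqxx//.
    exact: inHe Hs.
  + have hs := inHe _ _ He Hs; have ht := inHe _ _ Ke Kt.
    move: tz; rewrite (arc_point_inner hs) (arc_point_inner ht) => -[ts].
    suff : (set0 : set R) s by [].
    by rewrite -HK; split; rewrite // -ts.
- apply: le_trans (length_measure_points_ge vA He cS1).
  by rewrite lH -EFinD lee_fin /r; lra.
- have eB : inr e \notin B by rewrite !inE eqxx.
  apply: le_trans (length_measure_points_ge eB Ke cS2).
  rewrite lK -EFinD lee_fin /r.
  by have := lenE (inr e |: A)%SET; rewrite lv' -/B; lra.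
Qed.

End lengths.

(* The points of [Q], with the sets of measurable trace on every arc; the node
   [v0] serves only to make the type pointed. *)
Definition sample_point (R : realType) (Q : network R) (v0 : nodes Q) := npoint Q.

(** * The defender's strategy: a uniformly distributed trap *)

Section uniform_point.
Context {R : realType} {Q : network R} (v0 : nodes Q).
Implicit Types (A S : set (npoint Q)).

HB.instance Definition _ := Choice.on (sample_point v0).
HB.instance Definition _ := isPointed.Build (sample_point v0) (Node v0).

Definition arcwise_measurable : set (set (sample_point v0)) :=
  [set A | forall e, measurable (arc_trace e A)].

Let arcwise_measurable0 : arcwise_measurable set0.
Proof. by move=> e; rewrite /arc_trace preimage_set0 setI0. Qed.

Let arcwise_measurableC A : arcwise_measurable A -> arcwise_measurable (~` A).
Proof.
move=> mA e; have -> : arc_trace e (~` A) = `]0, len e[ `\` arc_trace e A.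
  by apply/seteqP; split=> t; rewrite /arc_trace /=; tauto.
by apply: measurableD => //; exact: mA.
Qed.

Let arcwise_measurable_bigcup (F : (set (sample_point v0))^nat) :
  (forall i, arcwise_measurable (F i)) -> arcwise_measurable (\bigcup_i F i).
Proof.
move=> mF e; rewrite /arc_trace preimage_bigcup setI_bigcupr.
by apply: bigcup_measurable => i _; exact: mF.
Qed.

HB.instance Definition _ := isMeasurable.Build default_measure_display
  (sample_point v0) arcwise_measurable0 arcwise_measurableC
  arcwise_measurable_bigcup.

Definition uniform_law (A : set (sample_point v0)) : \bar R :=
  length_measure (A : set (npoint Q)).

Let uniform_law0 : uniform_law set0 = 0%E.
Proof. by apply: big1 => e _; rewrite preimage_set0 setI0 measure0. Qed.

Let uniform_law_ge0 A : (0 <= uniform_law A)%E.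
Proof. by apply: sume_ge0 => e _; exact: measure_ge0. Qed.

(** The finite sum over the arcs is exchanged with the partial sums, and Lebesgue measure is
    countably additive on each arc. *)
Let uniform_law_sigma_additive : semi_sigma_additive uniform_law.
Proof.
move=> F mF tF mUF; rewrite (_ : (fun n => _) = (fun n => \sum_(e : arcs Q)
    \sum_(0 <= i < n) lebesgue_measure (arc_trace e (F i)))%E).
  have -> : uniform_law (\bigcup_n F n) =
      (\sum_(e : arcs Q) lebesgue_measure (\bigcup_n arc_trace e (F n)))%E.
    apply: eq_bigr => e _; congr lebesgue_measure.
    by rewrite /arc_trace -setI_bigcupr -preimage_bigcup.
  apply: cvg_nnesum => [e _|e _].
    by near=> n; apply: sume_ge0 => i _; exact: measure_ge0.
  apply: measure_semi_sigma_additive.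
  - by move=> i; exact: mF.
  - apply/trivIsetP => i j _ _ ij; rewrite -subset0 => t [[_ ti] [_ tj]].
    move/trivIsetP : tF => /(_ i j I I ij).
    by rewrite -subset0; apply; split; [exact: ti|exact: tj].
  - by apply: bigcup_measurable => i _; exact: mF.
by apply/funext => n; rewrite exchange_big.
Unshelve. all: by end_near. Qed.

HB.instance Definition _ := isMeasure.Build _ _ _ uniform_law
  uniform_law0 uniform_law_ge0 uniform_law_sigma_additive.

Lemma connected_arcwise_measurable S : connected S ->
  measurable (S : set (sample_point v0)).
Proof.
move=> cS; suff : arcwise_measurable S by [].
by move=> e; exact: arc_trace_measurable.
Qed.

Hypothesis total_length : length_measure [set: npoint Q] = 1%:E.

HB.instance Definition _ :=
  Measure_isProbability.Build _ _ _ uniform_law total_length.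

Lemma trap_payoff_indic (S : connected_set Q) :
  (fun x : sample_point v0 => one_trap_payoff S x) =
  (fun x => length_measure (sval S) *
    (\1_(~` (sval S : set (sample_point v0))) x)%:E)%E.
Proof.
apply/funext => x; rewrite /one_trap_payoff indicE in_setC.
by case: (x \in _); rewrite ?mule0 ?mule1.
Qed.

Lemma measurable_trap_payoff (S : connected_set Q) :
  measurable_fun [set: sample_point v0] (fun x => one_trap_payoff S x).
Proof.
rewrite trap_payoff_indic; apply: measurable_funeM.
apply/measurable_EFinP; apply: measurable_indic.
by apply: measurableC; apply: connected_arcwise_measurable; exact: (svalP S).
Qed.

Definition uniform_trap : mixed (fun y x => @one_trap_payoff R Q x y) :=
  @Mixed R (npoint Q) (connected_set Q) _ _ (sample_point v0) uniform_law id
    measurable_trap_payoff.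

Lemma expected_uniform_trap (S : connected_set Q) :
  (expected_payoff uniform_trap S <= (1 / 4)%:E)%E.
Proof.
have mS := connected_arcwise_measurable (svalP S).
rewrite /expected_payoff /= trap_payoff_indic.
have lS : (uniform_law (sval S) <= 1)%E := probability_le1 uniform_law mS.
have lS0 := uniform_law_ge0 (sval S).
have fS : uniform_law (sval S) \is a fin_num.
  by rewrite ge0_fin_numE// (le_lt_trans lS) ?ltry.
have mC : measurable_fun setT
    (fun x => (\1_(~` (sval S : set (sample_point v0))) x)%:E : \bar R).
  by apply/measurable_EFinP; apply: measurable_indic; exact: measurableC.
rewrite ge0_integralZl//.
rewrite integral_indic ?setIT//; last exact: measurableC.
rewrite [X in (_ * X)%E](probability_setC uniform_law mS).
pose l := fine (uniform_law (sval S)).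
have lE : uniform_law (sval S) = l%:E by rewrite fineK.
suff : (l%:E * (1 - l%:E) <= (1 / 4)%:E)%E by rewrite -lE.
rewrite -EFinB -EFinM lee_fin.
(* The bound [l * (1 - l) <= 1 / 4] is the nonnegativity of this square. *)
have := sqr_ge0 (l - 1 / 2); rewrite expr2; lra.
Qed.

End uniform_point.

(** * The attacker's strategy: a fair choice between two disjoint sets *)

Section fair_coin.
Context {R : realType} {Q : network R} (S1 S2 : connected_set Q).
Hypothesis S12 : sval S1 `&` sval S2 = set0.

Let coin (b : bool) : connected_set Q := if b then S1 else S2.

Let measurable_coin_payoff y :
  measurable_fun [set: bool] (fun b => one_trap_payoff (coin b) y).
Proof. by []. Qed.

Definition coin_attack : mixed (@one_trap_payoff R Q) :=
  @Mixed R (connected_set Q) (npoint Q) _ _ bool (bernoulli_prob (1 / 2)) coin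
    measurable_coin_payoff.

Lemma expected_coin_attack y :
  ((1 / 2)%:E <= length_measure (sval S1))%E ->
  ((1 / 2)%:E <= length_measure (sval S2))%E ->
  ((1 / 4)%:E <= expected_payoff coin_attack y)%E.
Proof.
move=> l1 l2; have half01 : 0 <= (1 / 2 : R) <= 1 by apply/andP; split; lra.
have pay0 S : (0 <= one_trap_payoff S y)%E.
  by rewrite /one_trap_payoff; case: ifP => // _; apply: sume_ge0.
rewrite /expected_payoff /= integral_bernoulli_prob//=.
have half0 : (0 <= (1 / 2 : R)%:E)%E by rewrite lee_fin; lra.
have -> : (1 / 4)%:E = ((1 / 2 : R)%:E * (1 / 2)%:E)%E.
  by rewrite -EFinM; congr EFin; lra.
have -> : unstable.onem (1 / 2 : R) = 1 / 2 by rewrite /unstable.onem; lra.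
(* The trap misses at least one of the two disjoint sets. Only the term of a missed set is kept, the
   other one being nonnegative. *)
have [yS1|yS1] := boolP (y \in sval S1).
  apply: le_trans (leeDr _ _); last by rewrite mule_ge0.
  apply: lee_pmul => //; rewrite /one_trap_payoff ifF//.
  apply/negP => yS2; suff : (set0 : set (npoint Q)) y by [].
  by rewrite -S12; split; apply: set_mem.
apply: le_trans (leeDl _ _); last by rewrite mule_ge0.
by apply: lee_pmul => //; rewrite /one_trap_payoff (negbTE yS1).
Qed.

End fair_coin.

Theorem theorem6 (R : realType) (Q : network R)
    (total_length : length_measure [set: npoint Q] = 1%:E)
    (Q2 : two_connected Q) :
  has_value (@one_trap_payoff R Q) (1 / 4).
Proof.
have [S1 [S2 [c1 c2 S12 l1 l2]]] := connected_halves total_length Q2.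
have [e] := arc_exists total_length.
(* Both strategies guarantee [1 / 4] itself, so the same pair serves for every [eps]. *)
move=> eps eps0; split.
  exists (@coin_attack R Q (exist _ S1 c1) (exist _ S2 c2)) => y.
  apply: (le_trans _ (expected_coin_attack _ _ _ _)) => //.
  by rewrite lee_fin; lra.
exists (uniform_trap (src e) total_length) => S.
apply: le_trans (expected_uniform_trap _ _ _) _.
by rewrite lee_fin; lra.
Qed.
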